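(* Let $A=[a_{ij}]$, $1\leq i<\infty$, $1\leq j<\infty$, be an infinite symmetric matrix over the two-element field $\mathbb{Z}_2$ (that is, $a_{ij}\in\mathbb{Z}_2$ and $a_{ij}=a_{ji}$ for all positive integers $i,j$) such that each row of $A$ contains only finitely many $1$'s. Let $d=(a_{11},a_{22},\ldots)^T$ be its diagonal vector. Then the range of $A$ contains the vector $d$; that is, there exists a vector $x=(x_1,x_2,\ldots)^T$ with entries in $\mathbb{Z}_2$ such that $Ax=d$.
   Context: The vector $x$ is an arbitrary infinite sequence of elements of $\mathbb{Z}_2$ (it may have infinitely many nonzero entries). The product $Ax$ is the sequence whose $i$-th entry is $\sum_{j\ge 1} a_{ij}x_j\in\mathbb{Z}_2$; this sum has only finitely many nonzero terms because each row of $A$ has only finitely many $1$'s. The range of $A$ is the set of all vectors $Ax$ with $x$ an infinite sequence over $\mathbb{Z}_2$. *)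

(* Defs.v *)
From HB Require Import structures.
From mathcomp Require Import all_boot all_order all_algebra.
From mathcomp Require Import all_classical.

Set Implicit Arguments.
Unset Strict Implicit.
Unset Printing Implicit Defensive.

Import GRing.Theory.
Local Open Scope classical_set_scope.
Local Open Scope ring_scope.

(* Infinite vectors and matrices over Z_2 are functions on nat, so index n
   stands for the (n+1)-st row, column or entry. *)
Definition infvec : Type := nat -> 'F_2.
Definition infmx : Type := nat -> nat -> 'F_2.

Definition infmx_symmetric (A : infmx) : Prop := forall i j, A i j = A j i.

Definition row_finite (A : infmx) : Prop :=
  forall i, finite_set [set j | A i j = 1].

(* The sum over [set: nat] is the sum of the nonzero terms when there are
   finitely many of them (as is the case when A is row-finite), and 0
   otherwise. *)
Definition infmx_mulv (A : infmx) (x : infvec) : infvec :=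
  fun i => \sum_(j \in [set: nat]) (A i j * x j).

Definition infmx_range (A : infmx) : set infvec := range (infmx_mulv A).

Definition infmx_diag (A : infmx) : infvec := fun i => A i i.

(* Main.v *)
Require Import Defs.
From mathcomp Require Import all_boot all_order all_algebra.
From mathcomp Require Import all_classical.

(** The proof combines a finite solvability criterion with compactness.

    Finitely many rows.  By Fredholm's alternative, the equations
    (A x)_i = a_ii for i < n are jointly solvable as soon as every combination
    y of the first n rows that vanishes also satisfies
    \sum_i y_i a_ii = 0.  If y A = 0 then y A y^T = 0.  In the double sum
    y A y^T the terms (i, j) and (j, i) are equal because A is symmetric, so
    they cancel in characteristic 2, and what remains is
    \sum_i a_ii y_i ^ 2 = \sum_i a_ii y_i, because squaring is the identity on
    Z_2 ([truncated_diag_solvable]).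

    All rows.  Each equation constrains finitely many entries of x, which range
    over a finite set.  The space of sequences over a finite set is compact, so
    a system of such conditions whose finite subsystems are all solvable is
    itself solvable ([finitary_compactness]). *)

Set Implicit Arguments.
Unset Strict Implicit.
Unset Printing Implicit Defensive.

Import GRing.Theory.
Local Open Scope classical_set_scope.
Local Open Scope ring_scope.

Section Compactness.
Variables (T : finType) (P : nat -> (nat -> T) -> Prop).

Definition extendible (s : seq T) : Prop :=
  forall n, exists x, mkseq x (size s) = s /\ forall i, (i < n)%N -> P i x.

(** If no letter could be appended, each letter b would fail for the first N b
    conditions; there are finitely many letters, so a sequence extending s that
    meets the first max_b N b conditions has no possible next entry. *)
Lemma extendible_rcons s : extendible s -> exists b, extendible (rcons s b).
Proof.
move=> ext_s; apply: contrapT => no_ext.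
have bad b : exists n, ~ exists x, mkseq x (size (rcons s b)) = rcons s b /\
    forall i, (i < n)%N -> P i x.
  by apply/existsNP => ext_b; apply: no_ext; exists b.
have [N badN] := choice bad.
have [x [xs Px]] := ext_s (\max_b N b)%N.
apply: (badN (x (size s))); exists x; split=> [|i lt_i].
  by rewrite size_rcons mkseqS xs.
by apply: Px; apply: leq_trans lt_i _; exact: (leq_bigmax (F := N)).
Qed.

(** Compactness of T^nat in the form of König's lemma: a branch of the tree of
    extendible prefixes satisfies every condition that looks at finitely many
    entries. *)
Lemma finitary_compactness :
  (forall i, exists m, forall x y,
     (forall j, (j < m)%N -> x j = y j) -> P i x -> P i y) ->
  (forall n, exists x, forall i, (i < n)%N -> P i x) ->
  exists x, forall i, P i x.
Proof.
move=> finP solP; have [x0 _] := solP 0%N.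
pose next s := xget (x0 0%N) [set b | extendible (rcons s b)].
pose pre k := iter k (fun s => rcons s (next s)) [::].
pose x k := next (pre k).
have preE k : mkseq x k = pre k by elim: k => // k IHk; rewrite mkseqS IHk.
have ext_pre k : extendible (pre k).
  elim: k => [n|k /extendible_rcons[b ext_b]].
    by have [y Py] := solP n; exists y.
  exact: (@xgetI _ (x0 0%N) [set c | extendible (rcons (pre k) c)] b).
exists x => i; have [m Pm] := finP i.
have [y [yx Py]] := ext_pre m i.+1.
apply: (Pm y) => [j lt_jm|]; last exact: Py.
move: yx; rewrite -preE size_mkseq => /(congr1 (fun s => nth (x0 0%N) s j)).
by rewrite !nth_mkseq.
Qed.

End Compactness.

(** Off-diagonal terms come in equal pairs, which cancel in characteristic 2. *)
Lemma sum_symmetric_pchar2 (R : nzRingType) n (f : 'I_n -> 'I_n -> R) :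
  2 \in [pchar R] -> (forall i j, f i j = f j i) ->
  \sum_i \sum_j f i j = \sum_i f i i.
Proof.
move=> char2; elim: n f => [|n IHn] f f_sym; first by rewrite !big_ord0.
under eq_bigr do rewrite big_ord_recr /=.
rewrite big_split /= big_ord_recr /= IHn // [RHS]big_ord_recr /=.
rewrite [X in _ + X]big_ord_recr /=.
under [X in _ + X + _]eq_bigr do rewrite f_sym.
by rewrite addrA -[X in X + _ = _]addrA addrr_pchar2 // addr0.
Qed.

Lemma mulF2_idem (a : 'F_2) : a * a = a.
Proof. by case: a => [[|[|[]]] ?] //; apply/val_inj. Qed.

(** The n x m truncation of A has the diagonal in its column space as soon as
    the diagonal is orthogonal to every y with y A = 0; such y are spanned by
    the columns of the cokernel of the transpose.  The condition n <= m makes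
    the first n columns of the truncation a symmetric block S, and y S = 0 is
    all that the cancellation in y S y^T uses. *)
Lemma truncated_diag_solvable (A : infmx) n m : infmx_symmetric A ->
  (n <= m)%N ->
  exists x : infvec, forall i, (i < n)%N -> \sum_(j < m) A i j * x j = A i i.
Proof.
move=> A_sym le_nm.
pose Bt : 'M['F_2]_(m, n) := \matrix_(j, i) A i j.
pose d : 'rV['F_2]_n := \row_i A i i.
have /submxP[u du] : (d <= Bt)%MS.
  rewrite submxE; apply/eqP/rowP => k; rewrite [LHS]mxE [RHS]mxE.
  pose y (i : 'I_n) : 'F_2 := cokermx Bt i k.
  have yA (j : 'I_n) : \sum_(i < n) A i j * y i = 0.
    have /matrixP/(_ (widen_ord le_nm j) k) := mulmx_coker Bt.
    rewrite [LHS]mxE [RHS]mxE => yBt; rewrite -[RHS]yBt.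
    by apply: eq_bigr => i _; rewrite [Bt _ _]mxE.
  pose f (i j : 'I_n) := A j i * y j * y i.
  transitivity (\sum_i f i i).
    by apply: eq_bigr => i _; rewrite [d _ _]mxE /f -mulrA mulF2_idem.
  rewrite -sum_symmetric_pchar2; first last.
  - by move=> i j; rewrite /f A_sym mulrAC.
  - exact: pchar_Fp.
  by apply: big1 => i _; rewrite -mulr_suml yA mul0r.
exists (fun j => if insub j is Some j' then u 0 j' else 0) => i lt_in.
have /rowP/(_ (Ordinal lt_in)) := du; rewrite !mxE /= => ->.
by apply: eq_bigr => j _; rewrite mxE valK mulrC.
Qed.

Lemma row_finite_bound (A : infmx) i : row_finite A ->
  exists m, forall j, (m <= j)%N -> A i j = 0.
Proof.
move=> /(_ i)/finite_seqP[s As]; exists (\max_(j <- s) j).+1 => j lt_sj.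
have F2P (a : 'F_2) : a <> 1 -> a = 0.
  by case: a => [[|[|[]]] ?] // a1; [apply/val_inj | case: a1; apply/val_inj].
apply: F2P => Aij; have: [set j | A i j = 1] j by [].
rewrite As /= => j_s; move: lt_sj.
by rewrite ltnNge (leq_bigmax_seq (F := id)).
Qed.

Lemma infmx_mulvE (A : infmx) x i m : (forall j, (m <= j)%N -> A i j = 0) ->
  infmx_mulv A x i = \sum_(j < m) A i j * x j.
Proof.
move=> A0; rewrite /infmx_mulv (fsbig_ord _ _ (fun j => A i j * x j)).
apply/esym/fsbig_widen => // j [_ /=] /negP.
by rewrite -leqNgt => /A0 ->; rewrite mul0r.
Qed.

Theorem theorem3p1 (A : infmx) (A_sym : infmx_symmetric A)
    (A_fin : row_finite A) :
  infmx_range A (infmx_diag A).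
Proof.
have [w w0] := choice (fun i => row_finite_bound i A_fin).
suff [x Ax] : exists x, forall i, infmx_mulv A x i = A i i.
  by exists x => //; apply/funext.
apply: (@finitary_compactness 'F_2 (fun i x => infmx_mulv A x i = A i i)).
  move=> i; exists (w i) => x y xy.
  rewrite !(infmx_mulvE _ (w0 i)) => <-.
  by apply: eq_bigr => j _; rewrite xy.
(* Truncating at m columns loses no entry of the first n rows, and m >= n keeps
   the symmetric block inside the truncation. *)
move=> n; pose m := maxn n (\max_(i < n) w i)%N.
have [x Ax] := truncated_diag_solvable A_sym (leq_maxl n _ : n <= m)%N.
exists x => i lt_in; rewrite -Ax //; apply: infmx_mulvE => j le_mj.
apply: w0; apply: leq_trans le_mj; rewrite leq_max; apply/orP; right.
exact: (leq_bigmax (F := fun i : 'I_n => w i) (Ordinal lt_in)).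
Qed.
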